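(* Let $S$ be an LA-semigroup with left identity $e$. Then $S$ is fully prime if and only if every ideal of $S$ is idempotent (i.e. $I = I^2$ for every ideal $I$ of $S$) and the set of ideals of $S$ is totally ordered under inclusion.
   Context: An LA-semigroup (left almost semigroup) is a set $S$ with a binary operation satisfying the left invertive law $(ab)c=(cb)a$ for all $a,b,c\in S$ (the operation is not assumed associative). A left identity is an element $e\in S$ with $ex=x$ for all $x\in S$. For subsets $A,B\subseteq S$, $AB=\{ab: a\in A, b\in B\}$ and $A^2=AA$. A subset $I\subseteq S$ is a right (left) ideal if $IS\subseteq I$ ($SI\subseteq I$), and an ideal if it is both. An ideal $P$ of $S$ is prime if for all ideals $A,B$ of $S$, $AB\subseteq P$ implies $A\subseteq P$ or $B\subseteq P$. $S$ is fully prime if every ideal of $S$ is prime. The set of ideals of $S$ is totally ordered under inclusion if for all ideals $A,B$ of $S$, either $A\subseteq B$ or $B\subseteq A$. *)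

(* Defs.v *)
From mathcomp Require Import all_boot.
From mathcomp Require Import classical_sets.

Set Implicit Arguments.
Unset Strict Implicit.
Unset Printing Implicit Defensive.

Local Open Scope classical_set_scope.

Definition left_invertive (S : Type) (op : S -> S -> S) : Prop :=
  forall a b c : S, op (op a b) c = op (op c b) a.

Definition setprod (S : Type) (op : S -> S -> S) (A B : set S) : set S :=
  [set op a b | a in A & b in B].

Definition right_ideal (S : Type) (op : S -> S -> S) (I : set S) : Prop :=
  setprod op I setT `<=` I.

Definition left_ideal (S : Type) (op : S -> S -> S) (I : set S) : Prop :=
  setprod op setT I `<=` I.

(* Neither nonemptiness nor properness is required: set0 and setT are ideals. *)
Definition ideal (S : Type) (op : S -> S -> S) (I : set S) : Prop :=
  right_ideal op I /\ left_ideal op I.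

Definition prime_ideal (S : Type) (op : S -> S -> S) (P : set S) : Prop :=
  ideal op P /\
  forall A B : set S, ideal op A -> ideal op B ->
    setprod op A B `<=` P -> A `<=` P \/ B `<=` P.

Definition fully_prime (S : Type) (op : S -> S -> S) : Prop :=
  forall P : set S, ideal op P -> prime_ideal op P.

Definition idempotent_set (S : Type) (op : S -> S -> S) (I : set S) : Prop :=
  I = setprod op I I.

Definition ideals_totally_ordered (S : Type) (op : S -> S -> S) : Prop :=
  forall A B : set S, ideal op A -> ideal op B -> A `<=` B \/ B `<=` A.

(* Main.v *)
Require Import Defs.
From mathcomp Require Import all_boot.
From mathcomp Require Import classical_sets.

Local Open Scope classical_set_scope.

(** Primeness of [P] is only ever tested on products of two ideals, so each
    direction is a matter of choosing [P].  If all ideals are prime, testing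
    [P := I I] on the pair [(I, I)] gives [I `<=` I I], and testing
    [P := A `&` B], which contains [A B], on the pair [(A, B)] makes [A] and [B]
    comparable.  Conversely, if [A `<=` B] then [A = A A `<=` A B], so
    [A B `<=` P] puts the smaller of the two ideals inside [P].

    The one point that needs the LA-semigroup laws is that [I I] is again an
    ideal ([ideal_setprod_self]).  The left invertive law absorbs factors on the
    right; for factors on the left, the left identity upgrades the medial law to
    the exchange law [a (b c) = b (a c)]. *)

Section LASemigroup.

Variables (S : Type) (op : S -> S -> S).

Lemma setprodS (A A' B B' : set S) :
  A `<=` A' -> B `<=` B' -> setprod op A B `<=` setprod op A' B'.
Proof.
move=> sA sB _ [a Aa [b Bb <-]].
by exists a; [exact: sA | exists b; [exact: sB |]].
Qed.

Lemma ideal_mulr (I : set S) (a s : S) : ideal op I -> I a -> I (op a s).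
Proof. by case=> rI _ Ia; apply: rI; exists a => //; exists s. Qed.

Lemma ideal_mull (I : set S) (a s : S) : ideal op I -> I a -> I (op s a).
Proof. by case=> _ lI Ia; apply: lI; exists s => //; exists a. Qed.

Lemma setprod_sub_setI (A B : set S) :
  ideal op A -> ideal op B -> setprod op A B `<=` A `&` B.
Proof.
move=> iA iB _ [a Aa [b Bb <-]].
by split; [exact: ideal_mulr | exact: ideal_mull].
Qed.

Lemma ideal_setI (A B : set S) :
  ideal op A -> ideal op B -> ideal op (A `&` B).
Proof.
move=> iA iB; split.
  by move=> _ [a [Aa Ba] [s _ <-]]; split; apply: ideal_mulr.
by move=> _ [s _ [a [Aa Ba] <-]]; split; apply: ideal_mull.
Qed.

Lemma fully_prime_total : fully_prime op -> ideals_totally_ordered op.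
Proof.
move=> fp A B iA iB.
have [_ prAB] := fp _ (ideal_setI A B iA iB).
by case: (prAB A B iA iB (setprod_sub_setI A B iA iB)) => sub;
  [left | right] => x /sub [].
Qed.

Lemma idempotent_total_fully_prime :
  (forall I : set S, ideal op I -> idempotent_set op I) ->
  ideals_totally_ordered op -> fully_prime op.
Proof.
move=> idem tot P iP; split=> // A B iA iB sABP.
case: (tot A B iA iB) => sub; [left | right].
- by rewrite (idem A iA); apply: subset_trans sABP; apply: setprodS.
- by rewrite (idem B iB); apply: subset_trans sABP; apply: setprodS.
Qed.

Hypothesis hS : left_invertive op.

Lemma left_invertive_medial (a b c d : S) :
  op (op a b) (op c d) = op (op a c) (op b d).
Proof. by rewrite hS (hS c d b) hS. Qed.

Variable e : S.
Hypothesis he : left_id e op.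

(** Medial law with first factor [e], which lets the two inner factors swap. *)
Lemma left_invertive_exchange (a b c : S) : op a (op b c) = op b (op a c).
Proof. by rewrite -{1}(he a) left_invertive_medial he. Qed.

(** A factor [s] multiplying [a b] can be moved next to [b]: on the right
    [(a b) s = (s b) a], on the left [s (a b) = a (s b)].  Both results lie in
    [I I] because [s b] is in [I]. *)
Lemma ideal_setprod_self (I : set S) : ideal op I -> ideal op (setprod op I I).
Proof.
move=> iI; split.
  move=> _ [_ [a Ia [b Ib <-]] [s _ <-]]; rewrite hS.
  by exists (op s b); [exact: ideal_mull | exists a].
move=> _ [s _ [_ [a Ia [b Ib <-]] <-]]; rewrite left_invertive_exchange.
by exists a => //; exists (op s b) => //; exact: ideal_mull.
Qed.

Lemma fully_prime_idempotent (I : set S) :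
  fully_prime op -> ideal op I -> idempotent_set op I.
Proof.
move=> fp iI; apply/seteqP; split; last first.
  by move=> x /(setprod_sub_setI I I iI iI) [].
have [_ prII] := fp _ (ideal_setprod_self I iI).
by case: (prII I I iI iI (@subset_refl _ _)).
Qed.

End LASemigroup.

Theorem theorem2 (S : Type) (op : S -> S -> S) (e : S)
    (hS : left_invertive op) (he : left_id e op) :
  fully_prime op <->
  (forall I : set S, ideal op I -> idempotent_set op I) /\
  ideals_totally_ordered op.
Proof.
split=> [fp | [idem tot]]; last exact: idempotent_total_fully_prime.
split; last exact: fully_prime_total.
by move=> I; apply: (fully_prime_idempotent _ _ hS e he).
Qed.
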